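(* Let $Q\in\mathfrak X_{(0,1)}(\mathcal B_{\mathbf Q})$ be the gauge BRST operator and $\overline Q\in\mathfrak X_{(0,-1)}(\mathcal B_{\mathbf Q})$ the gauge anti-BRST operator. Then $$[\overline Q,\overline Q]\equiv2\overline Q^2\equiv0\qquad\text{and}\qquad[Q,\overline Q]\equiv Q\circ\overline Q+\overline Q\circ Q\equiv0,$$ i.e. $\overline Q$ is a homological vector field with respect to the gauge ghost degree that anticommutes with $Q$.
   Context: Setting. $(M,g)$ is a spacetime (smooth, connected, time-orientable Lorentzian manifold) with $g_{\mu\nu}=\eta_{\mu\nu}+\varkappa h_{\mu\nu}$ ($\eta$ Minkowski background metric, $h$ graviton). $G\cong U(1)\times\widetilde G$ (with $\widetilde G$ compact semisimple) is the gauge group, $\mathfrak g$ its Lie algebra with structure constants $f^a{}_{bc}$, $\mathrm g$ the gauge coupling constant, $\xi$ a gauge fixing parameter. The fields are sections of the globally trivial $\mathbb Z^2$-graded super bundle $\mathcal B_{\mathbf Q}\to M$; with bidegree (graviton-ghost degree, gauge ghost degree): $h_{\mu\nu}$, vielbein $e$, gauge boson $A^a_\mu$, Higgs/Goldstone vector $\Phi$, fermion vector $\Psi$, auxiliary (Lautrup–Nakanishi) fields $B^\rho$, $b_a$ of degree $(0,0)$; graviton-ghost $C_\rho$: $(1,0)$; graviton-antighost $\overline C^\rho$: $(-1,0)$; gauge ghost $c^a$: $(0,1)$; gauge antighost $\overline c_a$: $(0,-1)$. Parity is total degree mod 2 (odd ghosts anticommute); gauge indices are raised and lowered with $\delta_{ab}$.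 $\mathfrak X_{(i,j)}(\mathcal B_{\mathbf Q})$ denotes super vector fields of bidegree $(i,j)$, acting as superderivations on graded-symmetric polynomial functionals of the fields and their derivatives. The supercommutator is $[X_1,X_2]=X_1X_2-(-1)^{p_1p_2}X_2X_1$. An odd vector field $\Xi$ with $[\Xi,\Xi]=2\Xi^2=0$ is called cohomological if it has degree $1$ and homological if it has degree $-1$. Gauge BRST operator $Q$ (commuting with $\partial_\mu$): $QA^a_\mu=\frac1\xi\partial_\mu c^a+\mathrm gf^a{}_{bc}c^bA^c_\mu$; $Qc^a=\frac{\mathrm g}2f^a{}_{bc}c^bc^c$; $Q\overline c_a=\frac1\xi b_a$; $Qb_a=0$; $Q\delta_{ab}=0$; $Qh_{\mu\nu}=QC_\rho=Q\overline C^\rho=QB^\rho=Q\eta_{\mu\nu}=Q\Gamma^\rho{}_{\mu\nu}=0$; $Q\Phi=\mathrm gc^a(\mathfrak H_a\cdot\Phi)$; $Q\Psi=\mathrm gc^a(\mathfrak S_a\cdot\Psi)$, where $\mathfrak H_a,\mathfrak S_a$ are the infinitesimal actions (Lie algebra representations of $\mathfrak g$) of the gauge group on the Higgs bundle and on the twisted spinor bundle. Gauge anti-BRST operator $\overline Q$: obtained from $Q$ by replacing $c$ by $\overline c$ (so e.g. $\overline QA^a_\mu=\frac1\xi\partial_\mu\overline c^a+\mathrm gf^a{}_{bc}\overline c^bA^c_\mu$), together with the changes $\overline Qc^a=-\frac1\xi b^a+\mathrm gf^a{}_{bc}\overline c^bc^c$, $\overline Q\,\overline c_a=\frac{\mathrm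 g}2f_{abc}\overline c^b\overline c^c$, $\overline Qb_a=\mathrm gf_{abc}\overline c^bb^c$. *)

(* Defs.v *)
From HB Require Import structures.
From mathcomp Require Import all_boot all_order all_algebra.
From mathcomp Require Import boolp reals.

Set Implicit Arguments.
Unset Strict Implicit.
Unset Printing Implicit Defensive.

Import Order.TTheory GRing.Theory Num.Theory.
Local Open Scope ring_scope.
Local Open Scope quotient_scope.

Definition oddz (k : int) : bool := odd `|k|%N.

Lemma oddzD k l : oddz (k + l) = oddz k (+) oddz l.
Proof.
have oddzE m : (-1) ^+ oddz m = (-1) ^ m :> rat.
  rewrite /oddz signr_odd; case: m => m //.
  by rewrite NegzE abszN absz_nat -exprnN invr_sign.
have : (-1) ^+ oddz (k + l) = (-1) ^+ (oddz k (+) oddz l) :> rat.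
  by rewrite oddzE signr_addb !oddzE expfzDr.
by case: (oddz _) (_ (+) _) => -[].
Qed.

(* [superalg K deg] is the supercommutative algebra over the commutative ring
   [K] (placed in bidegree (0,0)) freely generated by elements [sgen j] of
   bidegree [deg j]: formal expressions modulo the least congruence containing
   the axioms of a ring with central scalars [K] and the sign rule
   [x y = (-1)^(|x||y|) y x] for generators.  The parity is the total degree
   modulo 2.  An odd generator squares to zero as soon as 2 is invertible in
   [K], which is the case for the real algebras used below. *)

Inductive sexpr (K : Type) (J : Type) : Type :=
| SCoef of K
| SGen of J
| SAdd of sexpr K J & sexpr K J
| SMul of sexpr K J & sexpr K J.
Arguments SCoef {K J}.
Arguments SGen {K J}.

HB.instance Definition _ K J := gen_eqMixin (sexpr K J).
HB.instance Definition _ K J := gen_choiceMixin (sexpr K J).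

Definition total_parity (b : int * int) : bool := oddz (b.1 + b.2).

Section SuperAlgebra.
Variables (K : comNzRingType) (J : Type) (deg : J -> int * int).
Local Notation E := (sexpr K J).
Local Notation par j := (total_parity (deg j)).

Inductive seqv : E -> E -> Prop :=
| seqv_refl x : seqv x x
| seqv_sym x y : seqv x y -> seqv y x
| seqv_trans x y z : seqv x y -> seqv y z -> seqv x z
| seqv_add x x' y y' : seqv x x' -> seqv y y' -> seqv (SAdd x y) (SAdd x' y')
| seqv_mul x x' y y' : seqv x x' -> seqv y y' -> seqv (SMul x y) (SMul x' y')
| seqv_addA x y z : seqv (SAdd x (SAdd y z)) (SAdd (SAdd x y) z)
| seqv_addC x y : seqv (SAdd x y) (SAdd y x)
| seqv_add0 x : seqv (SAdd (SCoef 0) x) x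
| seqv_addN x : seqv (SAdd (SMul (SCoef (-1)) x) x) (SCoef 0)
| seqv_mulA x y z : seqv (SMul x (SMul y z)) (SMul (SMul x y) z)
| seqv_mul1 x : seqv (SMul (SCoef 1) x) x
| seqv_mulDl x y z : seqv (SMul (SAdd x y) z) (SAdd (SMul x z) (SMul y z))
| seqv_mulDr x y z : seqv (SMul x (SAdd y z)) (SAdd (SMul x y) (SMul x z))
| seqv_coefD a b : seqv (SCoef (a + b)) (SAdd (SCoef a) (SCoef b))
| seqv_coefM a b : seqv (SCoef (a * b)) (SMul (SCoef a) (SCoef b))
| seqv_coefC a x : seqv (SMul (SCoef a) x) (SMul x (SCoef a))
| seqv_sign i j : seqv (SMul (SGen i) (SGen j))
    (SMul (SCoef ((-1) ^+ (par i && par j))) (SMul (SGen j) (SGen i))).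

Definition seqvb (x y : E) : bool := `[< seqv x y >].

Lemma seqvb_refl : reflexive seqvb.
Proof. by move=> x; apply/asboolP; constructor. Qed.
Lemma seqvb_sym : symmetric seqvb.
Proof. by move=> x y; apply/asboolP/asboolP; apply: seqv_sym. Qed.
Lemma seqvb_trans : transitive seqvb.
Proof.
move=> y x z /asboolP xy /asboolP yz; apply/asboolP; exact: seqv_trans xy yz.
Qed.

Definition seqv_rel := EquivRel seqvb seqvb_refl seqvb_sym seqvb_trans.

Definition superalg := {eq_quot seqv_rel}.
HB.instance Definition _ := Choice.on superalg.
HB.instance Definition _ := EqQuotient.on superalg.

Definition sclass (x : E) : superalg := \pi_{eq_quot seqv_rel} x.

Lemma sclassP x y : seqv x y <-> sclass x = sclass y.
Proof.
by split=> [h|/eqmodP/asboolP//]; apply/eqmodP/asboolP.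
Qed.

Lemma sclass_ind (P : superalg -> Prop) : (forall x, P (sclass x)) -> forall u, P u.
Proof. by move=> h u; rewrite -(reprK u); exact: h. Qed.

Definition sadd (u v : superalg) := sclass (SAdd (repr u) (repr v)).
Definition smul (u v : superalg) := sclass (SMul (repr u) (repr v)).
Definition sopp (u : superalg) := sclass (SMul (SCoef (-1)) (repr u)).
Definition scoef (a : K) := sclass (SCoef a).
Definition sgen (j : J) := sclass (SGen j).

Lemma repr_sclass x : seqv (repr (sclass x)) x.
Proof. by apply/sclassP; exact: reprK. Qed.

Lemma saddE x y : sadd (sclass x) (sclass y) = sclass (SAdd x y).
Proof. by apply/sclassP/seqv_add; exact: repr_sclass. Qed.
Lemma smulE x y : smul (sclass x) (sclass y) = sclass (SMul x y).
Proof. by apply/sclassP/seqv_mul; exact: repr_sclass. Qed.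
Lemma soppE x : sopp (sclass x) = sclass (SMul (SCoef (-1)) x).
Proof. by apply/sclassP/seqv_mul; [exact: seqv_refl|exact: repr_sclass]. Qed.

Lemma saddA : associative sadd.
Proof.
elim/sclass_ind=> x; elim/sclass_ind=> y; elim/sclass_ind=> z.
by rewrite !saddE; apply/sclassP/seqv_addA.
Qed.
Lemma saddC : commutative sadd.
Proof.
by elim/sclass_ind=> x; elim/sclass_ind=> y; rewrite !saddE; apply/sclassP/seqv_addC.
Qed.
Lemma sadd0 : left_id (scoef 0) sadd.
Proof. by elim/sclass_ind=> x; rewrite saddE; apply/sclassP/seqv_add0. Qed.
Lemma saddN : left_inverse (scoef 0) sopp sadd.
Proof.
by elim/sclass_ind=> x; rewrite soppE saddE; apply/sclassP/seqv_addN.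
Qed.
HB.instance Definition _ := GRing.isZmodule.Build superalg saddA saddC sadd0 saddN.

Lemma smulA : associative smul.
Proof.
elim/sclass_ind=> x; elim/sclass_ind=> y; elim/sclass_ind=> z.
by rewrite !smulE; apply/sclassP/seqv_mulA.
Qed.
Lemma smul1l : left_id (scoef 1) smul.
Proof. by elim/sclass_ind=> x; rewrite smulE; apply/sclassP/seqv_mul1. Qed.
Lemma smul1r : right_id (scoef 1) smul.
Proof.
elim/sclass_ind=> x; rewrite smulE; apply/sclassP.
exact: seqv_trans (seqv_sym (seqv_coefC _ _)) (seqv_mul1 _).
Qed.
Lemma smulDl : left_distributive smul +%R.
Proof.
elim/sclass_ind=> x; elim/sclass_ind=> y; elim/sclass_ind=> z.
by rewrite /+%R /= !(saddE, smulE); apply/sclassP/seqv_mulDl.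
Qed.
Lemma smulDr : right_distributive smul +%R.
Proof.
elim/sclass_ind=> x; elim/sclass_ind=> y; elim/sclass_ind=> z.
by rewrite /+%R /= !(saddE, smulE); apply/sclassP/seqv_mulDr.
Qed.

(* Evaluation of all generators at 0; it separates 0 and 1. *)
Fixpoint sexpr_at0 (x : E) : K :=
  match x with
  | SCoef a => a
  | SGen _ => 0
  | SAdd y z => sexpr_at0 y + sexpr_at0 z
  | SMul y z => sexpr_at0 y * sexpr_at0 z
  end.

Lemma sexpr_at0_eqv x y : seqv x y -> sexpr_at0 x = sexpr_at0 y.
Proof.
elim=> //=.
- by move=> ? ? ? _ -> _ ->.
- by move=> ? ? ? ? _ -> _ ->.
- by move=> ? ? ? ? _ -> _ ->.
- by move=> *; rewrite addrA.
- by move=> *; rewrite addrC.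
- by move=> *; rewrite add0r.
- by move=> *; rewrite mulN1r addNr.
- by move=> *; rewrite mulrA.
- by move=> *; rewrite mul1r.
- by move=> *; rewrite mulrDl.
- by move=> *; rewrite mulrDr.
- by move=> *; rewrite mulrC.
- by move=> *; rewrite !mul0r mulr0.
Qed.

Lemma soner_neq0 : scoef 1 != 0.
Proof.
by apply/eqP => /sclassP /sexpr_at0_eqv /eqP; rewrite /= oner_eq0.
Qed.
HB.instance Definition _ :=
  GRing.Zmodule_isNzRing.Build superalg smulA smul1l smul1r smulDl smulDr soner_neq0.

Lemma scoefD a b : scoef (a + b) = scoef a + scoef b.
Proof. by rewrite [RHS]saddE; apply/sclassP/seqv_coefD. Qed.
Lemma scoefM a b : scoef (a * b) = scoef a * scoef b.
Proof. by rewrite [RHS]smulE; apply/sclassP/seqv_coefM. Qed.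

Definition sscale (a : K) (u : superalg) : superalg := scoef a * u.
Lemma sscaleA a b u : sscale a (sscale b u) = sscale (a * b) u.
Proof. by rewrite /sscale mulrA scoefM. Qed.
Lemma sscale1 : left_id 1 sscale.
Proof. exact: smul1l. Qed.
Lemma sscaleDr : right_distributive sscale +%R.
Proof. by move=> a u v; rewrite /sscale mulrDr. Qed.
Lemma sscaleDl u : {morph sscale^~ u : a b / a + b}.
Proof. by move=> a b; rewrite /sscale scoefD mulrDl. Qed.
HB.instance Definition _ :=
  GRing.Zmodule_isLmodule.Build K superalg sscaleA sscale1 sscaleDr sscaleDl.
Lemma sscaleAl (a : K) (u v : superalg) : a *: (u * v) = a *: u * v.
Proof. exact: mulrA. Qed.
HB.instance Definition _ := GRing.Lmodule_isLalgebra.Build K superalg sscaleAl.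

Lemma scoefC a (u : superalg) : scoef a * u = u * scoef a.
Proof.
by elim/sclass_ind: u => x; rewrite [LHS]smulE [RHS]smulE; apply/sclassP/seqv_coefC.
Qed.
Lemma scoefE (a : K) : scoef a = a%:A.
Proof. by rewrite -[LHS](mulr1 (scoef a)). Qed.
Lemma sscaleAr (a : K) (u v : superalg) : a *: (u * v) = u * (a *: v).
Proof. by rewrite -[LHS]/(scoef a * (u * v)) mulrA scoefC -mulrA. Qed.
HB.instance Definition _ := GRing.Lalgebra_isAlgebra.Build K superalg sscaleAr.

Lemma sgenC i j : sgen i * sgen j = (-1) ^+ (par i && par j) * (sgen j * sgen i).
Proof.
rewrite [LHS]smulE; have /sclassP -> := seqv_sign i j.
rewrite -!smulE -/(sgen j) -/(sgen i) -/(scoef _) scoefE.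
by case: (_ && _); rewrite ?expr0 ?expr1 ?scaleN1r ?scale1r.
Qed.

Lemma superalg_ind (P : superalg -> Prop) :
  (forall a : K, P a%:A) -> (forall j, P (sgen j)) ->
  (forall u v, P u -> P v -> P (u + v)) ->
  (forall u v, P u -> P v -> P (u * v)) -> forall u, P u.
Proof.
move=> Pc Pg Pa Pm; elim/sclass_ind; elim=> [a|j|x Px y Py|x Px y Py].
- by rewrite -/(scoef a) scoefE.
- exact: Pg.
- by rewrite -saddE; exact: Pa.
- by rewrite -smulE; exact: Pm.
Qed.

(* [homog k l u]: [u] lies in the component of bidegree (k,l). *)
Inductive homog : int -> int -> superalg -> Prop :=
| homog0 k l : homog k l 0
| homog_coef (a : K) : homog 0 0 a%:A
| homog_gen j : homog (deg j).1 (deg j).2 (sgen j)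
| homog_add k l u v : homog k l u -> homog k l v -> homog k l (u + v)
| homog_mul k l k' l' u v :
    homog k l u -> homog k' l' v -> homog (k + k') (l + l') (u * v).

End SuperAlgebra.

Arguments sgen {K J deg} j.

Section SuperVectorFields.
Variables (R : realType) (K : comAlgType R) (J : Type) (deg : J -> int * int).
Local Notation A := (superalg K deg).

(* Real-linear superderivations of bidegree (i,j); they need not annihilate
   [K], so that the total derivatives below are of bidegree (0,0). *)
Record super_vector_field (i j : int) := SuperVectorField {
  svf_fun :> A -> A;
  svf_add : {morph svf_fun : u v / u + v};
  svf_real : forall r : R, svf_fun (r%:A : K)%:A = 0;
  svf_homog : forall k l u, homog k l u -> homog (i + k) (j + l) (svf_fun u);
  svf_leibniz : forall k l u v, homog k l u ->
    svf_fun (u * v) =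
      svf_fun u * v + (-1) ^+ (oddz (i + j) && oddz (k + l)) * (u * svf_fun v)
}.

Definition supercommutator i1 j1 i2 j2
    (X1 : super_vector_field i1 j1) (X2 : super_vector_field i2 j2) (u : A) : A :=
  X1 (X2 u) - (-1) ^+ (oddz (i1 + j1) && oddz (i2 + j2)) * X2 (X1 u).

(* Homological with respect to the second (gauge ghost) degree. *)
Definition gauge_homological i j (X : super_vector_field i j) : Prop :=
  [/\ oddz (i + j), i = 0, j = -1 & forall u, supercommutator X X u = 0].

End SuperVectorFields.

Arguments svf_fun : simpl never.

Section Superderivation.
Variables (R : realType) (K : comAlgType R) (J : Type) (deg : J -> int * int).
Local Notation A := (superalg K deg).
Local Notation par j := (total_parity (deg j)).

Lemma scalarC (a : K) (u : A) : a%:A * u = u * a%:A.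
Proof. by rewrite -scalerAl -scalerAr mul1r mulr1. Qed.

Lemma ssignC (b : bool) (u : A) : u * (-1) ^+ b = (-1) ^+ b * u.
Proof. by case: b; rewrite ?(mulrN1, mulN1r, mulr1, mul1r). Qed.

Lemma ssignCA (b : bool) (u v : A) : u * ((-1) ^+ b * v) = (-1) ^+ b * (u * v).
Proof. by rewrite mulrA ssignC mulrA. Qed.

Lemma ssign_coef (b : bool) : ((-1) ^+ b)%:A = (-1) ^+ b :> A.
Proof. by case: b; rewrite ?scaleN1r ?scale1r. Qed.

Lemma homog_comm k l k' l' (u v : A) : homog k l u -> homog k' l' v ->
  u * v = (-1) ^+ (oddz (k + l) && oddz (k' + l')) * (v * u).
Proof.
move=> hu hv; elim: hu => {k l u}
  [k l|a|j|k l u1 u2 _ IH1 _ IH2|k l k2 l2 u1 u2 _ IH1 _ IH2].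
- by rewrite mul0r !mulr0.
- by rewrite scalarC mul1r.
- elim: hv => {k' l' v}
    [k l|a|i|k l u1 u2 _ IH1 _ IH2|k l k2 l2 u1 u2 _ IH1 _ IH2].
  + by rewrite mul0r !mulr0.
  + by rewrite andbF mul1r scalarC.
  + exact: sgenC.
  + by rewrite mulrDr IH1 IH2 -mulrDr -mulrDl.
  + rewrite mulrA IH1 -!mulrA IH2 ssignCA [LHS]mulrA -signr_addb.
    by rewrite [k + k2 + _]addrACA [oddz (k + l + _)]oddzD andb_addr.
- by rewrite mulrDl IH1 IH2 -mulrDr -mulrDr.
- rewrite -mulrA IH2 ssignCA [u1 * (v * u2)]mulrA IH1 -!mulrA.
  by rewrite [LHS]mulrA -signr_addb addrACA [oddz (k + l + _)]oddzD andb_addl addbC.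
Qed.

(* The parity involution u |-> (-1)^|u| u. *)
Fixpoint sexpr_invol (x : sexpr K J) : A :=
  match x with
  | SCoef a => a%:A
  | SGen j => (-1) ^+ par j * sgen j
  | SAdd y z => sexpr_invol y + sexpr_invol z
  | SMul y z => sexpr_invol y * sexpr_invol z
  end.

Lemma sexpr_invol_eqv x y : seqv deg x y -> sexpr_invol x = sexpr_invol y.
Proof.
elim=> {x y} //=.
- by move=> ? ? ? _ -> _ ->.
- by move=> ? ? ? ? _ -> _ ->.
- by move=> ? ? ? ? _ -> _ ->.
- by move=> *; rewrite addrA.
- by move=> *; rewrite addrC.
- by move=> *; rewrite scale0r add0r.
- by move=> *; rewrite scaleN1r mulN1r addNr scale0r.
- by move=> *; rewrite mulrA.
- by move=> *; rewrite scale1r mul1r.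
- by move=> *; rewrite mulrDl.
- by move=> *; rewrite mulrDr.
- by move=> *; rewrite scalerDl.
- by move=> *; rewrite mulr_algl scalerA.
- by move=> *; rewrite scalarC.
move=> i j; rewrite ssign_coef -!mulrA.
rewrite [sgen i * _]ssignCA sgenC [sgen j * (_ * sgen i)]ssignCA.
by rewrite [RHS]ssignCA [X in _ = _ * X]ssignCA [LHS]ssignCA.
Qed.

Definition sinvol (u : A) : A := sexpr_invol (repr u).

Lemma sinvol_class x : sinvol (sclass deg x) = sexpr_invol x.
Proof. apply: sexpr_invol_eqv; exact: repr_sclass. Qed.
Lemma sinvolD : {morph sinvol : u v / u + v}.
Proof.
elim/sclass_ind=> x; elim/sclass_ind=> y.
by rewrite [in LHS]/+%R /= saddE !sinvol_class.
Qed.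
Lemma sinvolM : {morph sinvol : u v / u * v}.
Proof.
elim/sclass_ind=> x; elim/sclass_ind=> y.
by rewrite [in LHS]/*%R /= smulE !sinvol_class.
Qed.
Lemma sinvol_coef (a : K) : sinvol a%:A = a%:A.
Proof. by rewrite -[in LHS](scoefE deg a) sinvol_class. Qed.
Lemma sinvol_gen j : sinvol (sgen j) = (-1) ^+ par j * sgen j.
Proof. exact: sinvol_class. Qed.

Lemma sinvol_homog k l u : homog k l u -> sinvol u = (-1) ^+ oddz (k + l) * u.
Proof.
elim=> {k l u} [k l|a|j|k l u1 u2 _ IH1 _ IH2|k l k2 l2 u1 u2 _ IH1 _ IH2].
- by rewrite mulr0 -(scale0r (1 : A)) sinvol_coef.
- by rewrite sinvol_coef mul1r.
- exact: sinvol_gen.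
- by rewrite sinvolD IH1 IH2 mulrDr.
- by rewrite sinvolM IH1 IH2 -mulrA ssignCA mulrA -signr_addb addrACA [oddz (k + l + _)]oddzD.
Qed.

Section Construction.
Variables (i j : int) (delta : {linear K -> K}) (val : J -> A).
Hypothesis delta_leibniz : forall a b, delta (a * b) = delta a * b + a * delta b.
Hypothesis delta_deg : (forall a, delta a = 0) \/ (i = 0 /\ j = 0).
Hypothesis val_homog : forall x, homog (i + (deg x).1) (j + (deg x).2) (val x).

Local Notation s := (oddz (i + j)).
Definition stwist (u : A) : A := if s then sinvol u else u.

Fixpoint sexpr_der (x : sexpr K J) : A :=
  match x with
  | SCoef a => (delta a)%:A
  | SGen x => val x
  | SAdd y z => sexpr_der y + sexpr_der z
  | SMul y z => sexpr_der y * sclass deg z + stwist (sclass deg y) * sexpr_der z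
  end.

Lemma stwistD : {morph stwist : u v / u + v}.
Proof. by rewrite /stwist; case: s => // u v; rewrite sinvolD. Qed.
Lemma stwistM : {morph stwist : u v / u * v}.
Proof. by rewrite /stwist; case: s => // u v; rewrite sinvolM. Qed.
Lemma stwist_coef (a : K) : stwist a%:A = a%:A.
Proof. by rewrite /stwist sinvol_coef; case: s. Qed.
Lemma stwist_gen x : stwist (sgen x) = (-1) ^+ (s && par x) * sgen x.
Proof. by rewrite /stwist sinvol_gen; case: s; rewrite //= mul1r. Qed.
Lemma stwist_homog k l u :
  homog k l u -> stwist u = (-1) ^+ (s && oddz (k + l)) * u.
Proof. by rewrite /stwist; case: s => [/sinvol_homog//|_]; rewrite mul1r. Qed.

Lemma sclassD (x y : sexpr K J) : sclass deg (SAdd x y) = sclass deg x + sclass deg y.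
Proof. by rewrite [RHS]saddE. Qed.
Lemma sclassM (x y : sexpr K J) : sclass deg (SMul x y) = sclass deg x * sclass deg y.
Proof. by rewrite [RHS]smulE. Qed.
Lemma sclass_coef (a : K) : sclass deg (SCoef a) = a%:A.
Proof. by rewrite -scoefE. Qed.

Lemma delta1 : delta 1 = 0.
Proof.
by have /eqP := delta_leibniz 1 1; rewrite !mulr1 mul1r -subr_eq0 opprD addrA subrr
  add0r oppr_eq0 => /eqP.
Qed.
Lemma deltaN1 : delta (-1) = 0.
Proof. by rewrite linearN /= delta1 oppr0. Qed.

Lemma stwist_delta (a : K) (u : A) : stwist u * (delta a)%:A = u * (delta a)%:A.
Proof.
case: delta_deg => [->|[i0 j0]]; first by rewrite scale0r !mulr0.
by rewrite /stwist i0 j0.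
Qed.

Lemma sexpr_der_eqv x y : seqv deg x y -> sexpr_der x = sexpr_der y.
Proof.
elim=> {x y} //=.
- by move=> ? ? ? _ -> _ ->.
- by move=> ? ? ? ? _ -> _ ->.
- by move=> x x' y y' /sclassP -> -> /sclassP -> ->.
- by move=> *; rewrite addrA.
- by move=> *; rewrite addrC.
- by move=> *; rewrite linear0 scale0r add0r.
- move=> x; rewrite deltaN1 linear0 scale0r mul0r add0r sclass_coef stwist_coef.
  by rewrite scaleN1r mulN1r addNr.
- by move=> *; rewrite !sclassM stwistM !mulrDl !mulrDr !mulrA addrA.
- move=> x; rewrite delta1 scale0r mul0r add0r sclass_coef stwist_coef.
  by rewrite scale1r mul1r.
- by move=> *; rewrite sclassD stwistD !mulrDl addrACA.
- by move=> *; rewrite sclassD !mulrDr addrACA.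
- by move=> *; rewrite linearD scalerDl.
- move=> a b; rewrite !sclass_coef stwist_coef delta_leibniz scalerDl.
  by rewrite !mulr_algl !scalerA.
- move=> a x; rewrite !sclass_coef stwist_coef stwist_delta addrC.
  by rewrite !scalarC.
move=> x y.
have e0 : delta ((-1) ^+ (par x && par y)) = 0.
  by case: (_ && _); rewrite ?delta1 ?deltaN1.
rewrite e0 scale0r mul0r add0r sclass_coef stwist_coef ssign_coef.
rewrite -![sclass _ (SGen _)]/(sgen _) !stwist_gen.
have parE z : oddz (i + (deg z).1 + (j + (deg z).2)) = s (+) par z.
  by rewrite addrACA [LHS]oddzD.
rewrite (homog_comm (val_homog x) (homog_gen K deg y)) parE -/(par y).
rewrite -[_ * sgen x * _]mulrA (homog_comm (homog_gen K deg x) (val_homog y)) parE -/(par x).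
rewrite -[_ * sgen y * _]mulrA [RHS]mulrDr addrC !mulrA -!signr_addb -!mulrA.
congr (_ * _ + _ * _); congr (_ ^+ nat_of_bool _);
  by case: s (par x) (par y) => -[] [].
Qed.

Definition sder (u : A) : A := sexpr_der (repr u).

Lemma sder_class x : sder (sclass deg x) = sexpr_der x.
Proof. apply: sexpr_der_eqv; exact: repr_sclass. Qed.
Lemma sderD : {morph sder : u v / u + v}.
Proof.
elim/sclass_ind=> x; elim/sclass_ind=> y.
by rewrite -sclassD !sder_class.
Qed.
Lemma sderM u v : sder (u * v) = sder u * v + stwist u * sder v.
Proof.
elim/sclass_ind: u => x; elim/sclass_ind: v => y.
by rewrite -sclassM !sder_class.
Qed.
Lemma sder_coef (a : K) : sder a%:A = (delta a)%:A.
Proof. by rewrite -sclass_coef sder_class. Qed.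
Lemma sder_gen x : sder (sgen x) = val x.
Proof. exact: sder_class. Qed.

Lemma sder_real (r : R) : sder (r%:A : K)%:A = 0.
Proof. by rewrite sder_coef linearZ /= delta1 scaler0 scale0r. Qed.

Lemma sder_homog k l u : homog k l u -> homog (i + k) (j + l) (sder u).
Proof.
elim=> {k l u} [k l|a|x|k l u1 u2 _ IH1 _ IH2|k l k2 l2 u1 u2 h1 IH1 h2 IH2].
- by rewrite -(scale0r (1 : A)) sder_coef linear0 scale0r; exact: homog0.
- rewrite sder_coef; case: delta_deg => [->|[-> ->]].
    by rewrite scale0r; exact: homog0.
  exact: homog_coef.
- rewrite sder_gen; exact: val_homog.
- by rewrite sderD; exact: homog_add.
rewrite sderM; apply: homog_add; first by rewrite !addrA; exact: homog_mul.
rewrite (stwist_homog h1) -mulrA.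
have h := homog_mul h1 IH2.
rewrite (addrCA i) (addrCA j).
case: (_ && _); last by rewrite mul1r.
rewrite -(scaleN1r (1 : A)) -[_ + (i + _)]add0r -[_ + (j + _)]add0r.
by apply: homog_mul => //; exact: homog_coef.
Qed.

Lemma sder_leibniz k l u v : homog k l u ->
  sder (u * v) = sder u * v + (-1) ^+ (s && oddz (k + l)) * (u * sder v).
Proof. by move=> h; rewrite sderM (stwist_homog h) mulrA. Qed.

Definition superderivation : super_vector_field K deg i j :=
  SuperVectorField sderD sder_real sder_homog sder_leibniz.

Lemma superderivation_coef (a : K) : superderivation a%:A = (delta a)%:A.
Proof. exact: sder_coef. Qed.
Lemma superderivation_gen x : superderivation (sgen x) = val x.
Proof. exact: sder_gen. Qed.
Lemma superderivationM u v :
  superderivation (u * v) = superderivation u * v + stwist u * superderivation v.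
Proof. exact: sderM. Qed.

End Construction.
End Superderivation.

Section GaugeAlgebra.
Variables (R : realType) (n : nat) (f : 'I_n -> 'I_n -> 'I_n -> R).

(* [f a b c] is f^a_{bc}: the bracket of the basis is [t_b, t_c] = f^a_{bc} t_a. *)
Definition lie_structure_constants : Prop :=
  (forall a b c, f a b c = - f a c b) /\
  (forall a b c d,
     \sum_(e < n) (f a b e * f e c d + f a c e * f e d b + f a d e * f e b c) = 0).

Definition lie_ad (x : 'rV[R]_n) : 'M[R]_n :=
  \matrix_(c, a) \sum_(b < n) f a b c * x 0 b.
Definition lie_bracket (x y : 'rV[R]_n) : 'rV[R]_n := y *m lie_ad x.
Definition lie_killing (x y : 'rV[R]_n) : R := \tr (lie_ad x *m lie_ad y).

(* The Lie algebra of U(1) x G~, G~ compact semisimple: the direct sum of a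
   central line and of an ideal with negative definite Killing form.  The
   Killing form of an ideal is the restriction of the ambient one. *)
Definition u1_plus_compact_semisimple : Prop :=
  exists (u : 'rV[R]_n) (W : 'M[R]_n),
    [/\ u != 0 /\ (forall x, lie_bracket u x = 0),
        (u :&: W)%MS = 0, row_full (u + W)%MS,
        forall x w : 'rV[R]_n, (w <= W)%MS -> (lie_bracket x w <= W)%MS
      & forall w : 'rV[R]_n, (w <= W)%MS -> w != 0 -> lie_killing w w < 0].

Definition lie_representation m (rho : 'I_n -> 'M[R]_m) : Prop :=
  forall b c, rho b *m rho c - rho c *m rho b = \sum_(a < n) f a b c *: rho a.

End GaugeAlgebra.

(* Unordered pairs of spacetime indices, for components symmetric in mu, nu. *)
Definition sympair (d : nat) := {mn : 'I_d * 'I_d | (mn.1 <= mn.2)%N}.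

(* The Christoffel symbols of g = eta + kappa h are not polynomial in h; they
   are adjoined as even generators so that functionals may involve them.
   Real components of the fields: [d] is the dimension of spacetime, [n] that
   of the gauge Lie algebra, [p] and [q] the (real) ranks of the Higgs and of
   the twisted spinor bundle. *)
Inductive field (d n p q : nat) : Type :=
| Graviton of sympair d
| Vielbein of 'I_d & 'I_d
| Christoffel of 'I_d & sympair d
| GaugeBoson of 'I_n & 'I_d
| Higgs of 'I_p
| Fermion of 'I_q
| GravitonAux of 'I_d
| GaugeAux of 'I_n
| GravitonGhost of 'I_d
| GravitonAntighost of 'I_d
| GaugeGhost of 'I_n
| GaugeAntighost of 'I_n.
Arguments Graviton {d n p q}.
Arguments Vielbein {d n p q}.
Arguments Christoffel {d n p q}.
Arguments GaugeBoson {d n p q}.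
Arguments Higgs {d n p q}.
Arguments Fermion {d n p q}.
Arguments GravitonAux {d n p q}.
Arguments GaugeAux {d n p q}.
Arguments GravitonGhost {d n p q}.
Arguments GravitonAntighost {d n p q}.
Arguments GaugeGhost {d n p q}.
Arguments GaugeAntighost {d n p q}.

Definition field_bidegree d n p q (phi : field d n p q) : int * int :=
  match phi with
  | GravitonGhost _ => (1, 0)
  | GravitonAntighost _ => (-1, 0)
  | GaugeGhost _ => (0, 1)
  | GaugeAntighost _ => (0, -1)
  | _ => (0, 0)
  end.

(* [(phi, I)] stands for the iterated partial derivative of the field component
   [phi] with multi-index [I]. *)
Definition jet (d n p q : nat) : Type := (field d n p q * {ffun 'I_d -> nat})%type.

Definition jet_bidegree d n p q (j : jet d n p q) := field_bidegree j.1.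

(* The functions on spacetime enter through the commutative real algebra [K]
   they form and the commuting coordinate derivations of [K]. *)
Record coordinate_derivations (R : realType) (K : comAlgType R) (d : nat) :=
  CoordinateDerivations {
    dcoord :> 'I_d -> {linear K -> K};
    dcoord_leibniz : forall mu a b, dcoord mu (a * b) = dcoord mu a * b + a * dcoord mu b;
    dcoord_comm : forall mu nu a, dcoord mu (dcoord nu a) = dcoord nu (dcoord mu a)
  }.

Section GaugeBRST.
Variables (R : realType) (d n p q : nat) (K : comAlgType R).
Variable (D : coordinate_derivations K d).
Variables (f : 'I_n -> 'I_n -> 'I_n -> R).
Variables (H : 'I_n -> 'M[R]_p) (S : 'I_n -> 'M[R]_q) (g xi : R).
Local Notation F := (field d n p q).
Local Notation deg := (@jet_bidegree d n p q).
Local Notation A := (superalg K deg).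

Definition jet_succ (mu : 'I_d) (j : jet d n p q) : jet d n p q :=
  (j.1, [ffun nu => (j.2 nu + (nu == mu))%N]).

Lemma jet_succ_homog mu (j : jet d n p q) :
  homog (0 + (deg j).1) (0 + (deg j).2) (sgen (jet_succ mu j) : A).
Proof. by rewrite !add0r; exact: (homog_gen K deg (jet_succ mu j)). Qed.

(* [total_derivative mu] acts on the coefficients as [D mu] and sends the jet
   (phi, I) to (phi, I + e_mu). *)
Definition total_derivative (mu : 'I_d) : super_vector_field K deg 0 0 :=
  superderivation (dcoord_leibniz D mu) (or_intror (conj erefl erefl))
    (jet_succ_homog mu).

Definition fld (phi : F) : A := sgen (phi, [ffun=> 0%N]).

Definition rscale (r : R) (u : A) : A := (r%:A : K) *: u.
Local Notation "r *:: u" := (rscale r u) (at level 40).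

Local Notation c := (fun a => fld (GaugeGhost a)).
Local Notation cb := (fun a => fld (GaugeAntighost a)).
Local Notation b := (fun a => fld (GaugeAux a)).

(* f^a_{bc} u^b v^c.  Indices are raised and lowered with delta_{ab}, so the
   components of f_{abc} and f^a_{bc}, of b_a and b^a, etc. coincide. *)
Definition fcontract (a : 'I_n) (u v : 'I_n -> A) : A :=
  \sum_(k < n) \sum_(l < n) f a k l *:: (u k * v l).

(* The infinitesimal gauge transformation with odd parameter [gh].  Its default
   value 0 on gauge ghosts and auxiliary gauge fields is overridden below. *)
Definition gauge_transformation (gh : 'I_n -> A) (phi : F) : A :=
  match phi with
  | GaugeBoson a mu => xi^-1 *:: total_derivative mu (gh a)
      + g *:: fcontract a gh (fun k => fld (GaugeBoson k mu))
  | Higgs i => g *:: \sum_(a < n) gh a * (\sum_(k < p) H a i k *:: fld (Higgs k))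
  | Fermion i => g *:: \sum_(a < n) gh a * (\sum_(k < q) S a i k *:: fld (Fermion k))
  | _ => 0
  end.

Definition gauge_BRST_value (phi : F) : A :=
  match phi with
  | GaugeGhost a => (g / 2) *:: fcontract a c c
  | GaugeAntighost a => xi^-1 *:: b a
  | GaugeAux a => 0
  | _ => gauge_transformation c phi
  end.

Definition gauge_antiBRST_value (phi : F) : A :=
  match phi with
  | GaugeGhost a => - (xi^-1 *:: b a) + g *:: fcontract a cb c
  | GaugeAntighost a => (g / 2) *:: fcontract a cb cb
  | GaugeAux a => g *:: fcontract a cb b
  | _ => gauge_transformation cb phi
  end.

(* A super vector field commuting with the total derivatives, annihilating the
   functions on spacetime (in particular eta_{mu nu} and delta_{ab}), with
   prescribed values on the fields. *)
Definition acts_on_fields_by (value : F -> A) i j (X : super_vector_field K deg i j) : Prop :=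
  [/\ forall phi, X (fld phi) = value phi,
      forall a : K, X a%:A = 0
    & forall mu u, X (total_derivative mu u) = total_derivative mu (X u)].

Definition is_gauge_BRST (Q : super_vector_field K deg 0 1) : Prop :=
  acts_on_fields_by gauge_BRST_value Q.
Definition is_gauge_antiBRST (Q : super_vector_field K deg 0 (-1)) : Prop :=
  acts_on_fields_by gauge_antiBRST_value Q.

Local Notation "'td" := total_derivative.

Lemma tdM mu (u v : A) : 'td mu (u * v) = 'td mu u * v + u * 'td mu v.
Proof. exact: superderivationM. Qed.
Lemma td_coef mu (a : K) : 'td mu a%:A = (D mu a)%:A.
Proof. exact: superderivation_coef. Qed.
Lemma td_gen mu j : 'td mu (sgen j) = sgen (jet_succ mu j).
Proof. exact: superderivation_gen. Qed.
Lemma td_homog mu k l (u : A) : homog k l u -> homog k l ('td mu u).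
Proof. by move/(svf_homog ('td mu)); rewrite !add0r. Qed.

Lemma tdC mu nu (u : A) : 'td mu ('td nu u) = 'td nu ('td mu u).
Proof.
elim/superalg_ind: u => [a|j|u v Pu Pv|u v Pu Pv].
- by rewrite !td_coef dcoord_comm.
- rewrite !td_gen; congr (sgen (_, _)); apply/ffunP=> k; rewrite !ffunE.
  by rewrite addnAC.
- by rewrite !svf_add Pu Pv.
- by rewrite !(tdM, svf_add) Pu Pv -!addrA; congr (_ + _); rewrite addrCA.
Qed.

Definition multi_derivative (I : {ffun 'I_d -> nat}) (u : A) : A :=
  foldr (fun mu w => iter (I mu) ('td mu) w) u (enum 'I_d).

Lemma iter_tdC mu nu m (u : A) : 'td mu (iter m ('td nu) u) = iter m ('td nu) ('td mu u).
Proof. by elim: m => //= m IH; rewrite tdC IH. Qed.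

Lemma multi_derivative_succ mu (I : {ffun 'I_d -> nat}) (u : A) :
  multi_derivative [ffun nu => (I nu + (nu == mu))%N] u = 'td mu (multi_derivative I u).
Proof.
rewrite /multi_derivative.
have: mu \in enum 'I_d by rewrite mem_enum.
elim: (enum 'I_d) (enum_uniq 'I_d) => //= nu s IH /andP[nus us].
rewrite inE ffunE iter_tdC; case: eqVneq nus => [<- nus _|neq _ /= /IH ->//]; last first.
  by rewrite addn0.
rewrite addn1 iterSr; congr (iter _ _ _).
congr ('td mu _).
elim: s nus {IH us} => //= k s IH; rewrite inE negb_or => /andP[kmu /IH ->].
by rewrite ffunE [k == mu]eq_sym (negPf kmu) addn0.
Qed.

Lemma multi_derivative_homog I k l u : homog k l u -> homog k l (multi_derivative I u).
Proof.
move=> hu; rewrite /multi_derivative; elim: (enum _) => //= mu s IH.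
by elim: (I mu) => //= m; exact: td_homog.
Qed.

Section Prolongation.
Variables (i j : int) (value : F -> A).
Hypothesis value_homog : forall phi,
  homog (i + (field_bidegree phi).1) (j + (field_bidegree phi).2) (value phi).

Lemma prolong_homog (x : jet d n p q) :
  homog (i + (deg x).1) (j + (deg x).2) (multi_derivative x.2 (value x.1)).
Proof. exact/multi_derivative_homog/value_homog. Qed.

Definition zero_lin : {linear K -> K} := \0.
Lemma zero_lin_leibniz a a' : zero_lin (a * a') = zero_lin a * a' + a * zero_lin a'.
Proof. by rewrite mul0r mulr0 addr0. Qed.

Definition prolong : super_vector_field K deg i j :=
  superderivation zero_lin_leibniz (or_introl (fun a => erefl)) prolong_homog.

Lemma prolongP : acts_on_fields_by value prolong.
Proof.
have pc (a : K) : prolong a%:A = 0 by rewrite superderivation_coef scale0r.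
have pg x : prolong (sgen x) = multi_derivative x.2 (value x.1).
  exact: superderivation_gen.
have pM v w : prolong (v * w) = prolong v * w + stwist i j v * prolong w.
  exact: superderivationM.
split=> [phi|//|mu u].
- rewrite pg /multi_derivative; elim: (enum _) => //= mu s ->.
  by rewrite ffunE.
have invol_td (w : A) : stwist i j ('td mu w) = 'td mu (stwist i j w).
  rewrite /stwist; case: oddz => //; elim/superalg_ind: w => [a|x|v w Pv Pw|v w Pv Pw].
  - by rewrite td_coef !sinvol_coef td_coef.
  - rewrite td_gen !sinvol_gen -ssign_coef tdM td_coef td_gen ssign_coef.
    rewrite (_ : D mu _ = 0) ?scale0r ?mul0r ?add0r//.
    by case: total_parity;
      rewrite ?(deltaN1 (dcoord_leibniz D mu)) ?(delta1 (dcoord_leibniz D mu)).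
  - by rewrite svf_add !sinvolD Pv Pw svf_add.
  - by rewrite tdM sinvolD !sinvolM Pv Pw tdM.
elim/superalg_ind: u => [a|x|v w Pv Pw|v w Pv Pw].
- by rewrite td_coef !pc -(scale0r (1 : A)) td_coef linear0.
- by rewrite td_gen !pg multi_derivative_succ.
- by rewrite !svf_add Pv Pw.
- by rewrite tdM svf_add !pM svf_add !tdM Pv Pw invol_td addrACA.
Qed.

End Prolongation.

Lemma homogZ (a : K) k l (u : A) : homog k l u -> homog k l (a *: u).
Proof.
move=> hu; have := homog_mul (homog_coef deg a) hu.
by rewrite !add0r mulr_algl.
Qed.

Lemma homog_sum I (r : seq I) k l (E : I -> A) :
  (forall x, homog k l (E x)) -> homog k l (\sum_(x <- r) E x).
Proof.
by move=> h; elim/big_ind: _ => //; [exact: homog0|move=> *; exact: homog_add].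
Qed.

Lemma homog_fcontract a k l k' l' (u v : 'I_n -> A) :
  (forall x, homog k l (u x)) -> (forall x, homog k' l' (v x)) ->
  homog (k + k') (l + l') (fcontract a u v).
Proof.
by move=> hu hv; apply: homog_sum => x; apply: homog_sum => y; exact/homogZ/homog_mul.
Qed.

Lemma homog_fld phi : homog (field_bidegree phi).1 (field_bidegree phi).2 (fld phi).
Proof. exact: (homog_gen K deg (phi, [ffun=> 0%N])). Qed.

Lemma gauge_transformation_homog l (gh : 'I_n -> A) phi :
  (forall a, homog 0 l (gh a)) -> field_bidegree phi = (0, 0) ->
  homog (0 + (field_bidegree phi).1) (l + (field_bidegree phi).2)
    (gauge_transformation gh phi).
Proof.
move=> hgh ->; have hf := homog_fld.
case: phi => *; rewrite /= ?addr0; try exact: homog0.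
- apply: homog_add; first exact/homogZ/td_homog.
  apply: homogZ; rewrite -[0]addr0 -[l]addr0; apply: homog_fcontract => // x.
  exact: (hf (GaugeBoson _ _)).
- apply: homogZ; apply: homog_sum => a; rewrite -[0]addr0 -[l]addr0.
  apply: homog_mul => //; apply: homog_sum => x; exact/homogZ/(hf (Higgs _)).
- apply: homogZ; apply: homog_sum => a; rewrite -[0]addr0 -[l]addr0.
  apply: homog_mul => //; apply: homog_sum => x; exact/homogZ/(hf (Fermion _)).
Qed.

Lemma gauge_BRST_exists : exists Q, is_gauge_BRST Q.
Proof.
have hc a : homog 0 1 (fld (GaugeGhost a)) := homog_fld (GaugeGhost a).
suff h phi : homog (0 + (field_bidegree phi).1) (1 + (field_bidegree phi).2)
    (gauge_BRST_value phi) by exists (prolong h); exact: prolongP.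
case: phi => *; try (by apply: gauge_transformation_homog); try exact: homog0.
- exact/homogZ/(homog_fcontract _ hc hc).
- exact/homogZ/(homog_fld (GaugeAux _)).
Qed.

Lemma gauge_antiBRST_exists : exists Q, is_gauge_antiBRST Q.
Proof.
have hc a : homog 0 1 (fld (GaugeGhost a)) := homog_fld (GaugeGhost a).
have hcb a : homog 0 (-1) (fld (GaugeAntighost a)) := homog_fld (GaugeAntighost a).
have hb a : homog 0 0 (fld (GaugeAux a)) := homog_fld (GaugeAux a).
suff h phi : homog (0 + (field_bidegree phi).1) (-1 + (field_bidegree phi).2)
    (gauge_antiBRST_value phi) by exists (prolong h); exact: prolongP.
case: phi => *; try (by apply: gauge_transformation_homog); try exact: homog0.
- exact/homogZ/(homog_fcontract _ hcb hb).
- apply: homog_add; last exact/homogZ/(homog_fcontract _ hcb hc).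
  by rewrite -scaleN1r; apply/homogZ/homogZ.
- exact/homogZ/(homog_fcontract _ hcb hcb).
Qed.

End GaugeBRST.

(* Main.v *)
(* The anticommutator of two odd super vector fields is a derivation, and it
   commutes with the total derivatives when both fields do, so it vanishes as
   soon as it vanishes on the undifferentiated fields.
   On matter fields and gauge bosons, let X and Y be gauge transformations with
   odd parameters u and w.  The quadratic part of {X,Y} is minus the
   transformation with parameter g [u,w] because the Lie algebra acts by a
   representation (the adjoint one for A, b and c), and the part that comes from
   varying the parameters is the transformation with parameter X w + Y u.  They
   cancel since X w + Y u = g [u,w] both for X = Y = Qbar, u = w = cbar and for
   X = Q, Y = Qbar, u = c, w = cbar.
   Under Qbar the fields b and c also transform in the adjoint representation,
   up to a shift by b in the case of c.  What remains on ghosts is the Jacobi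
   identity in the forms [[u,u],u] = 0 and [w,[u,u]] = 2 [[u,w],u]. *)

Require Import Defs.
From mathcomp Require Import all_boot all_order all_algebra.
From mathcomp Require Import boolp reals.

Set Implicit Arguments.
Unset Strict Implicit.
Unset Printing Implicit Defensive.

Import GRing.Theory Num.Theory.
Local Open Scope ring_scope.

(** * Super vector fields and the anticommutator of two odd ones *)

Section SuperVectorFieldTheory.
Variables (R : realType) (K : comAlgType R) (J : Type) (deg : J -> int * int).
Local Notation A := (superalg K deg).

Section OneField.
Variables (i j : int) (X : super_vector_field K deg i j).

Lemma svf0 : X 0 = 0.
Proof. by apply: (addrI (X 0)); rewrite -svf_add !addr0. Qed.

Lemma svfN : {morph X : u / - u}.
Proof. by move=> u; apply: (addrI (X u)); rewrite -svf_add !subrr svf0. Qed.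

Lemma svf_sum I (r : seq I) (E : I -> A) : X (\sum_(x <- r) E x) = \sum_(x <- r) X (E x).
Proof. exact: (big_morph X (svf_add X) svf0). Qed.

(** Only real scalars are pulled out: a super vector field need not annihilate [K], and total
    derivatives do not. *)
Lemma svfZ (r : R) (u : A) : X ((r%:A : K) *: u) = (r%:A : K) *: X u.
Proof.
set a : K := r%:A.
have := svf_leibniz X u (homog_coef deg a).
by rewrite (svf_real X r) mul0r add0r andbF mul1r !(@mulr_algl _ A).
Qed.

End OneField.

Section Anticommutator.
Variables (i j i' j' : int).
Variables (X : super_vector_field K deg i j) (Y : super_vector_field K deg i' j').
Hypotheses (X_odd : oddz (i + j)) (Y_odd : oddz (i' + j')).

(** An odd field flips the parity of [u], so the mixed products [X u * Y v] and [Y u * X v] each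
    arise twice with opposite signs and cancel. *)
Lemma anticommutator_mul k l (u v : A) : homog k l u ->
  X (Y (u * v)) + Y (X (u * v)) = (X (Y u) + Y (X u)) * v + u * (X (Y v) + Y (X v)).
Proof.
move=> hu; rewrite !(svf_leibniz _ _ hu) X_odd Y_odd /= !svf_add.
have hX := svf_homog X hu; have hY := svf_homog Y hu.
have odd_shift a b : oddz (a + b) -> oddz (a + k + (b + l)) = ~~ oddz (k + l).
  by move=> ab; rewrite addrACA [LHS]oddzD ab.
rewrite (svf_leibniz X _ hY) (svf_leibniz Y _ hX) !odd_shift // X_odd Y_odd /=.
rewrite !mulrDl !mulrDr; case E: (oddz (k + l)).
  rewrite expr1 expr0 !mul1r !mulN1r !svfN !(svf_leibniz _ _ hu) X_odd Y_odd /= E expr1 !mulN1r.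
  rewrite !opprB addrACA [X in X + _]addrACA [X in _ + X]addrACA [LHS]addrACA.
  by rewrite -[- _ - _]opprD [X in _ - X]addrC subrr addr0.
rewrite expr1 expr0 !mul1r !mulN1r !(svf_leibniz _ _ hu) X_odd Y_odd /= E expr0 !mul1r.
rewrite addrACA [X in X + _]addrACA [X in _ + X]addrACA [LHS]addrACA.
by rewrite -opprD [_ * Y v + _]addrC [LHS]addrA addrK.
Qed.

Hypothesis XY_coef : forall a : K, X (Y a%:A) + Y (X a%:A) = 0.
Hypothesis XY_gen : forall x, X (Y (sgen x)) + Y (X (sgen x)) = 0.

(* The Leibniz rule needs a homogeneous left factor, so the induction is on
   left multipliers preserving the kernel. *)
Lemma anticommutator_eq0 u : X (Y u) + Y (X u) = 0.
Proof.
suff h v : X (Y v) + Y (X v) = 0 -> X (Y (u * v)) + Y (X (u * v)) = 0.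
  (* The unit is a coefficient, so it starts the chain of left multiplications. *)
  by rewrite -[u]mulr1; apply: h; rewrite -[1](scale1r (1 : A)); apply: XY_coef.
elim/superalg_ind: u v => [a|x|u1 u2 h1 h2|u1 u2 h1 h2] v hv.
- by rewrite (anticommutator_mul _ (homog_coef deg a)) XY_coef hv mul0r mulr0 addr0.
- by rewrite (anticommutator_mul _ (homog_gen K deg x)) XY_gen hv mul0r mulr0 addr0.
- by rewrite mulrDl !svf_add addrACA h1 // h2 // addr0.
- by rewrite -mulrA; apply/h1/h2.
Qed.

End Anticommutator.
End SuperVectorFieldTheory.

(** * Contraction of parameters and fields with a representation *)

Section Contraction.
Variables (R : realType) (d n p q : nat) (K : comAlgType R).
Local Notation A := (superalg K (@jet_bidegree d n p q)).
Local Notation "r *:: u" := (@rscale R d n p q K r u) (at level 40).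

Lemma rscaleDr r (u v : A) : r *:: (u + v) = r *:: u + r *:: v.
Proof. exact: scalerDr. Qed.
Lemma rscaleDl r s (u : A) : (r + s) *:: u = r *:: u + s *:: u.
Proof. by rewrite /rscale scalerDl scalerDl. Qed.
Lemma rscaleNr r (u : A) : r *:: (- u) = - (r *:: u).
Proof. exact: scalerN. Qed.
Lemma rscaleNl r (u : A) : (- r) *:: u = - (r *:: u).
Proof. by rewrite /rscale scaleNr scaleNr. Qed.
Lemma rscale0l (u : A) : 0 *:: u = 0.
Proof. by rewrite /rscale !scale0r. Qed.
Lemma rscale0r r : r *:: (0 : A) = 0.
Proof. exact: scaler0. Qed.
Lemma rscale1 (u : A) : 1 *:: u = u.
Proof. by rewrite /rscale !scale1r. Qed.
Lemma rscale2 (u : A) : 2 *:: u = u + u.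
Proof. by rewrite rscaleDl rscale1. Qed.
Lemma rscaleA r s (u : A) : r *:: (s *:: u) = (r * s) *:: u.
Proof. by rewrite /rscale scalerA -scalerAl mul1r scalerA. Qed.
Lemma rscale_eq0 r (u : A) : r != 0 -> r *:: u = 0 -> u = 0.
Proof. by move=> r0 ru; rewrite -[u]rscale1 -(mulVf r0) -rscaleA ru rscale0r. Qed.
Lemma rscaleAl r (u v : A) : r *:: u * v = r *:: (u * v).
Proof. by rewrite /rscale -scalerAl. Qed.
Lemma rscaleAr r (u v : A) : u * (r *:: v) = r *:: (u * v).
Proof. by rewrite /rscale -scalerAr. Qed.
Lemma rscale_sumr I (s : seq I) r (E : I -> A) :
  r *:: (\sum_(x <- s) E x) = \sum_(x <- s) r *:: E x.
Proof. exact: scaler_sumr. Qed.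
Lemma rscale_suml I (s : seq I) (r : I -> R) (u : A) :
  (\sum_(x <- s) r x) *:: u = \sum_(x <- s) r x *:: u.
Proof. exact: (big_morph (fun r => r *:: u) (fun r s => rscaleDl r s u) (rscale0l u)). Qed.

Lemma svf_rscale i j (X : super_vector_field K (@jet_bidegree d n p q) i j) r (u : A) :
  X (r *:: u) = r *:: X u.
Proof. exact: svfZ. Qed.

(** The infinitesimal action of the parameter [u] on the multiplet [v], where [t i k l] is the entry
    (i,l) of the k-th generator. For [t = f] it is the bracket, written [u,v] below. *)
Definition contract m (t : 'I_m -> 'I_n -> 'I_m -> R) i (u : 'I_n -> A) (v : 'I_m -> A) : A :=
  \sum_(k < n) \sum_(l < m) t i k l *:: (u k * v l).

Section ContractTheory.
Variables (m : nat) (t : 'I_m -> 'I_n -> 'I_m -> R) (i : 'I_m).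

Lemma eq_contract u u' v v' : u =1 u' -> v =1 v' -> contract t i u v = contract t i u' v'.
Proof. by move=> hu hv; do 2!apply: eq_bigr => ? _; rewrite hu hv. Qed.

Lemma contractDl u u' v :
  contract t i (fun k => u k + u' k) v = contract t i u v + contract t i u' v.
Proof.
rewrite -big_split; apply: eq_bigr => k _; rewrite -big_split; apply: eq_bigr => l _.
by rewrite mulrDl rscaleDr.
Qed.

Lemma contractDr u v v' :
  contract t i u (fun l => v l + v' l) = contract t i u v + contract t i u v'.
Proof.
rewrite -big_split; apply: eq_bigr => k _; rewrite -big_split; apply: eq_bigr => l _.
by rewrite mulrDr rscaleDr.
Qed.

Lemma contractZl r u v : contract t i (fun k => r *:: u k) v = r *:: contract t i u v.
Proof.
rewrite rscale_sumr; apply: eq_bigr => k _; rewrite rscale_sumr; apply: eq_bigr => l _.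
by rewrite rscaleAl !rscaleA mulrC.
Qed.

Lemma contractZr r u v : contract t i u (fun l => r *:: v l) = r *:: contract t i u v.
Proof.
rewrite rscale_sumr; apply: eq_bigr => k _; rewrite rscale_sumr; apply: eq_bigr => l _.
by rewrite rscaleAr !rscaleA mulrC.
Qed.

Lemma svf_contract i0 j0 (X : super_vector_field K (@jet_bidegree d n p q) i0 j0) k0 l0 u v :
  (forall k, homog k0 l0 (u k)) ->
  X (contract t i u v) = contract t i (X \o u) v
    + (-1) ^+ (oddz (i0 + j0) && oddz (k0 + l0)) *: contract t i u (X \o v).
Proof.
move=> hu.
rewrite svf_sum scaler_sumr -big_split; apply: eq_bigr => k _.
rewrite svf_sum scaler_sumr -big_split; apply: eq_bigr => l _ /=.
rewrite svf_rscale (svf_leibniz X _ (hu k)) rscaleDr; congr (_ + _).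
by case: (_ && _); rewrite ?expr0 ?scale1r ?mul1r // expr1 scaleN1r mulN1r rscaleNr.
Qed.

End ContractTheory.

(** This is [lie_representation] in entries, a form that covers the adjoint and the matter
    representations at once. *)
Definition tensor_representation (f : 'I_n -> 'I_n -> 'I_n -> R) m
    (t : 'I_m -> 'I_n -> 'I_m -> R) : Prop :=
  forall i a b l, \sum_(k < m) (t i a k * t k b l - t i b k * t k a l)
    = \sum_(e < n) f e a b * t i e l.

Variable f : 'I_n -> 'I_n -> 'I_n -> R.

(** This and the next expansion use the same monomials [u a * w b * v l], so that only their real
    coefficients remain to be compared. *)
Lemma contract_contract m (t : 'I_m -> 'I_n -> 'I_m -> R) i u w v :
  contract t i u (fun k => contract t k w v) =
  \sum_(a < n) \sum_(b < n) \sum_(l < m) (\sum_(k < m) t i a k * t k b l) *:: (u a * w b * v l).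
Proof.
apply: eq_bigr => a _.
under eq_bigr => k _.
  rewrite mulr_sumr rscale_sumr.
  under eq_bigr => b _ do rewrite mulr_sumr rscale_sumr.
  over.
rewrite exchange_big; apply: eq_bigr => b _ /=.
rewrite exchange_big; apply: eq_bigr => l _ /=.
by rewrite rscale_suml; apply: eq_bigr => k _; rewrite rscaleAr rscaleA mulrA.
Qed.

Lemma contract_bracket m (t : 'I_m -> 'I_n -> 'I_m -> R) i u w v :
  contract t i (fun e => contract f e u w) v =
  \sum_(a < n) \sum_(b < n) \sum_(l < m) (\sum_(e < n) f e a b * t i e l) *:: (u a * w b * v l).
Proof.
rewrite /contract.
under eq_bigr => e _.
  under eq_bigr => l _.
    rewrite mulr_suml rscale_sumr.
    under eq_bigr => a _ do rewrite mulr_suml rscale_sumr.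
    over.
  rewrite exchange_big /=.
  under eq_bigr => a _ do rewrite exchange_big.
  over.
rewrite exchange_big; apply: eq_bigr => a _ /=.
rewrite exchange_big; apply: eq_bigr => b _ /=.
rewrite exchange_big; apply: eq_bigr => l _ /=.
rewrite rscale_suml; apply: eq_bigr => e _.
by rewrite rscaleAl rscaleA mulrC.
Qed.

(* For odd parameters the commutator of two infinitesimal transformations
   becomes an anticommutator. *)
Lemma odd_representation m (t : 'I_m -> 'I_n -> 'I_m -> R) i u w v :
  tensor_representation f t -> (forall a b, w b * u a = - (u a * w b)) ->
  contract t i u (fun k => contract t k w v) + contract t i w (fun k => contract t k u v)
    = contract t i (fun e => contract f e u w) v.
Proof.
move=> rep anti; rewrite !contract_contract contract_bracket.
(* Swapping the two ghost indices in the second term turns its monomials into [w b * u a * v l];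
   anticommuting them gives the minus sign of the matrix commutator. *)
rewrite [X in _ + X]exchange_big -big_split; apply: eq_bigr => a _ /=.
rewrite -big_split; apply: eq_bigr => b _ /=.
rewrite -big_split; apply: eq_bigr => l _ /=.
by rewrite anti mulNr rscaleNr -rscaleNl -rscaleDl -rep sumrB.
Qed.

Hypothesis f_lie : lie_structure_constants f.

(** This is the Jacobi identity, rearranged by antisymmetry in the lower indices. *)
Lemma adjoint_representation : tensor_representation f f.
Proof.
move=> i a b l; have [anti jac] := f_lie.
apply/eqP; rewrite -subr_eq0 -sumrB -[X in _ == X](jac i a b l); apply/eqP.
apply: eq_bigr => e _.
by rewrite [f e l a]anti [f i l e]anti mulrN mulNr [f i e l * _]mulrC.
Qed.

(** The sign from anticommuting the entries cancels the one from the antisymmetry of [f]; for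
    commuting entries, treated next, only the latter remains. *)
Lemma contract_anticomm i u w :
  (forall a b, w b * u a = - (u a * w b)) -> contract f i w u = contract f i u w.
Proof.
move=> anti; rewrite /contract exchange_big; do 2!apply: eq_bigr => ? _ /=.
by rewrite anti (f_lie.1 i) rscaleNl rscaleNr opprK.
Qed.

Lemma contract_comm i u w :
  (forall a b, w b * u a = u a * w b) -> contract f i w u = - contract f i u w.
Proof.
move=> comm; rewrite /contract exchange_big -sumrN; apply: eq_bigr => ? _.
by rewrite -sumrN; apply: eq_bigr => ? _ /=; rewrite comm (f_lie.1 i) rscaleNl.
Qed.

End Contraction.

(** * Reduction from jets to undifferentiated fields *)

Section GaugeAnticommutators.
Variables (R : realType) (d n p q : nat) (K : comAlgType R).
Variable D : coordinate_derivations K d.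
Variables (f : 'I_n -> 'I_n -> 'I_n -> R).
Variables (H : 'I_n -> 'M[R]_p) (S : 'I_n -> 'M[R]_q) (g xi : R).
Local Notation deg := (@jet_bidegree d n p q).
Local Notation A := (superalg K deg).
Local Notation "r *:: u" := (@rscale R d n p q K r u) (at level 40).
Local Notation "'td" := (total_derivative n p q D).
Local Notation fld phi := (@fld R d n p q K phi).

(** Every jet arises from an undifferentiated field by total derivatives; the induction is on the
    order of the multi-index. *)
Lemma sgen_jet_ind (P : A -> Prop) :
  (forall phi, P (fld phi)) -> (forall mu u, P u -> P ('td mu u)) ->
  forall x : jet d n p q, P (sgen x).
Proof.
move=> Pfld Ptd [phi I].
have [s] := ubnP (\sum_k I k); elim: s I => // s IH I.
have [/forallP I0 _|/forallPn[mu Imu]] := boolP [forall k, I k == 0%N].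
  have -> : I = [ffun=> 0%N] by apply/ffunP => k; rewrite ffunE; apply/eqP/I0.
  exact: Pfld.
rewrite -lt0n in Imu => Is.
(* The truncated subtraction is exact because [I mu] is positive. *)
pose I' := [ffun k => (I k - (k == mu))%N].
have -> : sgen (phi, I) = 'td mu (sgen (phi, I')) :> A.
  rewrite td_gen; congr (sgen (_, _)); apply/ffunP => k; rewrite !ffunE.
  by case: eqVneq => [->|_]; rewrite ?subn1 ?addn1 ?prednK ?subn0 ?addn0.
apply: Ptd; apply: IH; rewrite -ltnS; apply: leq_trans Is; rewrite ltnS.
rewrite (bigD1 mu) // [X in (_ < X)%N](bigD1 mu) //= ffunE eqxx subn1.
rewrite -addSn prednK // leq_add2l; apply: leq_sum => k _.
by rewrite ffunE leq_subr.
Qed.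

Lemma acts_anticommutator_eq0 i j i' j' (X : super_vector_field K deg i j)
    (Y : super_vector_field K deg i' j') x y :
  acts_on_fields_by D x X -> acts_on_fields_by D y Y ->
  oddz (i + j) -> oddz (i' + j') ->
  (forall phi, X (y phi) + Y (x phi) = 0) -> forall u, X (Y u) + Y (X u) = 0.
Proof.
move=> [Xfld Xcoef Xtd] [Yfld Ycoef Ytd] Xodd Yodd XY.
apply: anticommutator_eq0 => // [a|].
  by rewrite Xcoef Ycoef !svf0 addr0.
apply: (sgen_jet_ind (P := fun u => X (Y u) + Y (X u) = 0)) => [phi|mu u hu]; first by rewrite Xfld Yfld.
by rewrite Xtd Ytd Xtd Ytd -svf_add hu svf0.
Qed.

Hypothesis f_lie : lie_structure_constants f.

Lemma contract0r m (t : 'I_m -> 'I_n -> 'I_m -> R) i (u : 'I_n -> A) :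
  contract t i u (fun=> 0) = 0.
Proof. by apply: big1 => a _; apply: big1 => k _; rewrite mulr0 rscale0r. Qed.

Lemma contract_matrix m (rho : 'I_n -> 'M[R]_m) (e : 'I_n -> A) (v : 'I_m -> A) i :
  \sum_(a < n) e a * (\sum_(k < m) rho a i k *:: v k) = contract (fun i a k => rho a i k) i e v.
Proof.
apply: eq_bigr => a _; rewrite mulr_sumr; apply: eq_bigr => k _.
by rewrite rscaleAr.
Qed.

Lemma matrix_representation m (rho : 'I_n -> 'M[R]_m) :
  lie_representation f rho -> tensor_representation f (fun i a k => rho a i k).
Proof.
move=> rep i a b l; have /matrixP/(_ i l) := rep a b.
rewrite !mxE summxE sumrB => ->; apply: eq_bigr => e _.
by rewrite mxE.
Qed.

(** * Anticommutators of gauge transformations with odd parameters *)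

Section GhostTransformations.
Variables (i j i' j' : int).
Variables (X : super_vector_field K deg i j) (Y : super_vector_field K deg i' j').
Hypotheses (X_odd : oddz (i + j)) (Y_odd : oddz (i' + j')).
Variables (k l k' l' : int) (u w : 'I_n -> A).
Hypotheses (u_homog : forall a, homog k l (u a)) (u_odd : oddz (k + l)).
Hypotheses (w_homog : forall a, homog k' l' (w a)) (w_odd : oddz (k' + l')).
(* The Maurer-Cartan equation of the parameters [u] of [X] and [w] of [Y]. *)
Hypothesis uw_bracket : forall a, X (w a) + Y (u a) = g *:: contract f a u w.

Lemma ghosts_anticomm a b : w b * u a = - (u a * w b).
Proof. by rewrite (homog_comm (w_homog b) (u_homog a)) u_odd w_odd expr1 mulN1r. Qed.

(** The multiplet [v] transforms linearly up to the shifts [su] and [sw]. Varying the parameters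
    gives g^2 times the action of [u,w], which cancels the iterated actions by [odd_representation];
    the last hypothesis cancels the terms containing shifts. *)
Lemma anticommutator_affine m (t : 'I_m -> 'I_n -> 'I_m -> R) (v su sw : 'I_m -> A) x :
  tensor_representation f t ->
  (forall y, X (v y) = su y + g *:: contract t y u v) ->
  (forall y, Y (v y) = sw y + g *:: contract t y w v) ->
  X (sw x) + Y (su x) = g *:: (contract t x w su + contract t x u sw) ->
  X (sw x + g *:: contract t x w v) + Y (su x + g *:: contract t x u v) = 0.
Proof.
move=> rep Xv Yv shift; rewrite !svf_add !svf_rscale addrACA shift -!rscaleDr.
rewrite (svf_contract t x X v w_homog) (svf_contract t x Y v u_homog).
rewrite X_odd Y_odd u_odd w_odd expr1 !scaleN1r [X in _ + X]addrACA -contractDl.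
rewrite (eq_contract _ _ uw_bracket (fun=> erefl)) contractZl.
rewrite (eq_contract _ _ (fun=> erefl) Xv) (eq_contract _ _ (fun=> erefl) Yv).
rewrite !contractDr !contractZr -(odd_representation _ _ rep ghosts_anticomm).
rewrite -opprD [X in _ - X]addrACA -rscaleDr opprD addrCA.
by rewrite addNKr [X in _ - _ *:: X]addrC subrr rscale0r.
Qed.

Lemma anticommutator_linear m (t : 'I_m -> 'I_n -> 'I_m -> R) (v : 'I_m -> A) x :
  tensor_representation f t ->
  (forall y, X (v y) = g *:: contract t y u v) ->
  (forall y, Y (v y) = g *:: contract t y w v) ->
  X (g *:: contract t x w v) + Y (g *:: contract t x u v) = 0.
Proof.
move=> rep Xv Yv.
have := @anticommutator_affine m t v (fun=> 0) (fun=> 0) x rep.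
rewrite !add0r !svf0 !contract0r !addr0 rscale0r; apply=> // y.
  by rewrite add0r.
by rewrite add0r.
Qed.

(** Here the shifts are the derivatives of the parameters divided by [xi], and the shift condition
    is the derivative of [uw_bracket]. *)
Lemma anticommutator_gauge_boson mu a :
  (forall mu a, X ('td mu a) = 'td mu (X a)) -> (forall mu a, Y ('td mu a) = 'td mu (Y a)) ->
  (forall b, X (fld (GaugeBoson b mu)) = gauge_transformation D f H S g xi u (GaugeBoson b mu)) ->
  (forall b, Y (fld (GaugeBoson b mu)) = gauge_transformation D f H S g xi w (GaugeBoson b mu)) ->
  X (gauge_transformation D f H S g xi w (GaugeBoson a mu))
    + Y (gauge_transformation D f H S g xi u (GaugeBoson a mu)) = 0.
Proof.
move=> Xtd Ytd XA YA.
apply: (anticommutator_affine (adjoint_representation f_lie) XA YA).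
rewrite !svf_rscale Xtd Ytd -rscaleDr -svf_add uw_bracket svf_rscale.
rewrite (svf_contract f a ('td mu) w u_homog) /= scale1r !contractZr -rscaleDr.
rewrite [contract f a ('td mu \o u) w](contract_anticomm f_lie) ?rscaleA ?[xi^-1 * g]mulrC //.
move=> b c /=; rewrite (homog_comm (td_homog D mu (u_homog c)) (w_homog b)).
by rewrite u_odd w_odd expr1 mulN1r.
Qed.

(** The fields on which the BRST and anti-BRST values override [gauge_transformation]. *)
Definition gauge_sector (phi : field d n p q) : bool :=
  match phi with GaugeAux _ | GaugeGhost _ | GaugeAntighost _ => true | _ => false end.

Hypotheses (H_rep : lie_representation f H) (S_rep : lie_representation f S).

Lemma anticommutator_gauge_transformation phi :
  (forall mu a, X ('td mu a) = 'td mu (X a)) -> (forall mu a, Y ('td mu a) = 'td mu (Y a)) ->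
  (forall psi, ~~ gauge_sector psi -> X (fld psi) = gauge_transformation D f H S g xi u psi) ->
  (forall psi, ~~ gauge_sector psi -> Y (fld psi) = gauge_transformation D f H S g xi w psi) ->
  ~~ gauge_sector phi ->
  X (gauge_transformation D f H S g xi w phi) + Y (gauge_transformation D f H S g xi u phi) = 0.
Proof.
move=> Xtd Ytd Xfld Yfld; have X00 : X 0 + Y 0 = 0 by rewrite !svf0 addr0.
case: phi => // [a mu|i0|i0] _.
- by apply: anticommutator_gauge_boson => // b; [exact: Xfld|exact: Yfld].
- rewrite /= !contract_matrix; apply: (anticommutator_linear _ (matrix_representation H_rep)) => y.
    by rewrite Xfld //= contract_matrix.
  by rewrite Yfld //= contract_matrix.
- rewrite /= !contract_matrix; apply: (anticommutator_linear _ (matrix_representation S_rep)) => y.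
    by rewrite Xfld //= contract_matrix.
  by rewrite Yfld //= contract_matrix.
Qed.

End GhostTransformations.

Lemma fcontractE a (u v : 'I_n -> A) : fcontract f a u v = contract f a u v.
Proof. by []. Qed.

(** * Jacobi identities for odd ghosts *)

Section GhostBrackets.
Variables (k l : int) (u : 'I_n -> A).
Hypotheses (u_homog : forall a, homog k l (u a)) (u_odd : oddz (k + l)).

(** The Leibniz rule gives [Xu,u] - [u,Xu]; as [X] makes the odd [u] even, both terms equal [Xu,u],
    which absorbs the factor one half. *)
Lemma svf_half_bracket i j (X : super_vector_field K deg i j) r a : oddz (i + j) ->
  X ((r / 2) *:: contract f a u u) = r *:: contract f a (X \o u) u.
Proof.
move=> Xodd; rewrite svf_rscale (svf_contract f a X u u_homog) Xodd u_odd expr1 scaleN1r.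
rewrite [contract f a u (X \o u)](contract_comm f_lie) ?opprK.
  by rewrite -rscale2 rscaleA divfK // pnatr_eq0.
move=> b c /=; rewrite (homog_comm (u_homog c) (svf_homog X (u_homog b))).
by rewrite addrACA [oddz (_ + _ + (k + l))]oddzD Xodd u_odd mul1r.
Qed.

Section TwoParameters.
Variables (k' l' : int) (w : 'I_n -> A).
Hypotheses (w_homog : forall a, homog k' l' (w a)) (w_odd : oddz (k' + l')).

(** The adjoint case of [odd_representation] with [u] as the field reads [u,[w,u]] + [w,[u,u]] =
    [[u,w],u]; since [w,u] is even and equals [u,w], the first term is -[[u,w],u]. *)
Lemma odd_jacobi a :
  contract f a w (fun e => contract f e u u) = 2 *:: contract f a (fun e => contract f e u w) u.
Proof.
have anti := ghosts_anticomm u_homog u_odd w_homog w_odd.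
have := odd_representation a u (adjoint_representation f_lie) anti.
rewrite [contract f a u _](contract_comm f_lie) => [|b c]; last first.
  rewrite (homog_comm (u_homog c) (homog_fcontract f b w_homog u_homog)).
  by rewrite addrACA [oddz (_ + _ + (k + l))]oddzD u_odd w_odd mul1r.
rewrite (eq_contract _ _ (fun e => contract_anticomm f_lie e anti) (fun=> erefl)).
by move/(canRL (addKr _)) ->; rewrite opprK rscale2.
Qed.

End TwoParameters.

(** By [odd_jacobi] with [w = u], [u,[u,u]] is 2 [[u,u],u], while evenness of [u,u] makes it
    -[[u,u],u]; hence three times the latter vanishes. *)
Lemma bracket_cubed a : contract f a (fun e => contract f e u u) u = 0.
Proof.
have jac := odd_jacobi u_homog u_odd a.
have comm : contract f a u (fun e => contract f e u u) = - contract f a (fun e => contract f e u u) u.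
  apply: (contract_comm f_lie) => b c.
  rewrite (homog_comm (u_homog c) (homog_fcontract f b u_homog u_homog)).
  by rewrite [k + k + _]addrACA [oddz (_ + _ + (k + l))]oddzD u_odd mul1r.
apply: (@rscale_eq0 _ _ _ _ _ _ 3); first by rewrite pnatr_eq0.
by rewrite mulrS rscaleDl rscale1 -jac comm subrr.
Qed.

Lemma contract_even_diag a (v : 'I_n -> A) :
  (forall b c, v b * v c = v c * v b) -> contract f a v v = 0.
Proof.
move=> comm; apply: (@rscale_eq0 _ _ _ _ _ _ 2); first by rewrite pnatr_eq0.
by rewrite rscale2 {1}(contract_comm f_lie a (fun b c => comm c b)) addNr.
Qed.

End GhostBrackets.

(** * Nilpotency of the anti-BRST operator *)

Local Notation c := (fun a => fld (GaugeGhost a)).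
Local Notation cb := (fun a => fld (GaugeAntighost a)).
Local Notation b := (fun a => fld (GaugeAux a)).

Hypotheses (H_rep : lie_representation f H) (S_rep : lie_representation f S).
Variable Qbar : super_vector_field K deg 0 (-1).
Hypothesis Qbar_antiBRST : is_gauge_antiBRST D f H S g xi Qbar.

Let c_homog a : homog 0 1 (fld (GaugeGhost a)) := homog_fld K (GaugeGhost a).
Let cb_homog a : homog 0 (-1) (fld (GaugeAntighost a)) := homog_fld K (GaugeAntighost a).
Let b_homog a : homog 0 0 (fld (GaugeAux a)) := homog_fld K (GaugeAux a).

Let Qbar_fld phi : Qbar (fld phi) = gauge_antiBRST_value D f H S g xi phi.
Proof. by case: Qbar_antiBRST. Qed.
Let Qbar_td mu u : Qbar ('td mu u) = 'td mu (Qbar u).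
Proof. by case: Qbar_antiBRST. Qed.
Let Qbar_transformation phi : ~~ gauge_sector phi ->
  gauge_antiBRST_value D f H S g xi phi = gauge_transformation D f H S g xi cb phi.
Proof. by case: phi. Qed.

Lemma antiBRST_square u : Qbar (Qbar u) + Qbar (Qbar u) = 0.
Proof.
have bracket a : Qbar (cb a) + Qbar (cb a) = g *:: contract f a cb cb.
  by rewrite Qbar_fld -rscale2 rscaleA mulrC divfK // pnatr_eq0.
move: u; apply: (acts_anticommutator_eq0 Qbar_antiBRST Qbar_antiBRST) => // phi.
have [|phiN] := boolP (gauge_sector phi); last first.
  rewrite Qbar_transformation //.
  apply: (anticommutator_gauge_transformation _ _ cb_homog _ cb_homog _ bracket) => // psi psiN.
    by rewrite Qbar_fld Qbar_transformation.
  by rewrite Qbar_fld Qbar_transformation.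
case: phi => // a _.
- apply: (anticommutator_linear _ _ cb_homog _ cb_homog _ bracket) => //.
  exact: adjoint_representation.
(* The ghost is an adjoint field shifted by -b/xi, and the shift itself transforms in the adjoint
   representation, as the affine lemma requires. *)
- have Qbarb e : Qbar (- (xi^-1 *:: b e)) = - (xi^-1 *:: (g *:: contract f e cb b)).
    by rewrite svfN svf_rscale Qbar_fld.
  apply: (anticommutator_affine (su := fun e => - (xi^-1 *:: b e))
    (sw := fun e => - (xi^-1 *:: b e)) _ _ cb_homog _ cb_homog _ bracket) => //.
    exact: adjoint_representation.
  rewrite Qbarb (eq_contract f a (fun=> erefl) (fun e => esym (rscaleNl _ _))) contractZr.
  by rewrite rscaleDr !rscaleA mulrN rscaleNl [g * _]mulrC.
(* On the antighost the square is a multiple of [[cb,cb],cb]. *)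
- rewrite /= !fcontractE (svf_half_bracket cb_homog) //.
  rewrite (eq_contract _ _ (fun e => Qbar_fld (GaugeAntighost e)) (fun=> erefl)) /=.
  by rewrite contractZl (bracket_cubed cb_homog) // !rscale0r addr0.
Qed.

(** * Anticommutation of the BRST and anti-BRST operators *)

Variable Q : super_vector_field K deg 0 1.
Hypothesis Q_BRST : is_gauge_BRST D f H S g xi Q.

Let Q_fld phi : Q (fld phi) = gauge_BRST_value D f H S g xi phi.
Proof. by case: Q_BRST. Qed.
Let Q_td mu u : Q ('td mu u) = 'td mu (Q u).
Proof. by case: Q_BRST. Qed.
Let Q_transformation phi : ~~ gauge_sector phi ->
  gauge_BRST_value D f H S g xi phi = gauge_transformation D f H S g xi c phi.
Proof. by case: phi. Qed.

Lemma BRST_antiBRST_anticomm u : Q (Qbar u) + Qbar (Q u) = 0.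
Proof.
have anti := ghosts_anticomm c_homog erefl cb_homog erefl.
(* The auxiliary terms b/xi of [Q (cb a)] and -b/xi of [Qbar (c a)] cancel. *)
have bracket a : Q (cb a) + Qbar (c a) = g *:: contract f a c cb.
  by rewrite Q_fld Qbar_fld /= addrA subrr add0r -(contract_anticomm f_lie a anti).
move: u; apply: (acts_anticommutator_eq0 Q_BRST Qbar_antiBRST) => // phi.
have [|phiN] := boolP (gauge_sector phi); last first.
  rewrite Q_transformation // Qbar_transformation //.
  apply: (anticommutator_gauge_transformation _ _ c_homog _ cb_homog _ bracket) => // psi psiN.
    by rewrite Q_fld Q_transformation.
  by rewrite Qbar_fld Qbar_transformation.
have comm_b e e' : b e * cb e' = cb e' * b e.
  by rewrite (homog_comm (b_homog e) (cb_homog e')) mul1r.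
case: phi => // a _ /=.
(* Since [Q] kills [b] and sends [cb] to b/xi, only a multiple of [b,b] is left, which vanishes for
   even [b]. *)
- rewrite svf0 addr0 fcontractE svf_rscale (svf_contract f a Q _ cb_homog) /=.
  rewrite (eq_contract f a (fun=> erefl) (fun e => Q_fld (GaugeAux e))) contract0r scaler0 addr0.
  rewrite (eq_contract f a (fun e => Q_fld (GaugeAntighost e)) (fun=> erefl)) contractZl.
  rewrite contract_even_diag ?rscale0r // => e e'.
  by rewrite (homog_comm (b_homog e) (b_homog e')) mul1r.
(* On the ghost the sum is g [Q cb + Qbar c, c] - g [cb, Q c], that is g^2 times [[c,cb],c] -
   [cb,[c,c]]/2, which is zero by [odd_jacobi]. *)
- rewrite !fcontractE (svf_half_bracket c_homog) //.
  rewrite svf_add svfN !svf_rscale Q_fld /= rscale0r oppr0 add0r.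
  rewrite (svf_contract f a Q c cb_homog) /= expr1 scaleN1r -rscaleDr addrAC -contractDl.
  rewrite (eq_contract f a bracket (fun=> erefl)) contractZl.
  rewrite (eq_contract f a (fun=> erefl) (fun e => Q_fld (GaugeGhost e))) contractZr.
  rewrite (odd_jacobi c_homog _ cb_homog) // rscaleA divfK ?pnatr_eq0 //.
  by rewrite subrr rscale0r.
(* On the antighost the two terms are g/xi times [b,cb] and [cb,b], which are opposite because [b]
   is even. *)
- rewrite !fcontractE (svf_half_bracket cb_homog) //.
  rewrite (eq_contract _ _ (fun e => Q_fld (GaugeAntighost e)) (fun=> erefl)) /=.
  rewrite contractZl svf_rscale Qbar_fld /=.
  rewrite [contract f a b cb](contract_comm f_lie) //.
  by rewrite !rscaleNr !rscaleA fcontractE [g * _]mulrC addNr.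
Qed.

End GaugeAnticommutators.

Theorem corollary4p4 (R : realType) (d n p q : nat) (K : comAlgType R)
    (D : coordinate_derivations K d)
    (f : 'I_n -> 'I_n -> 'I_n -> R) (H : 'I_n -> 'M[R]_p) (S : 'I_n -> 'M[R]_q)
    (g xi : R)
    (f_lie : lie_structure_constants f) (f_type : u1_plus_compact_semisimple f)
    (H_rep : lie_representation f H) (S_rep : lie_representation f S)
    (xi_neq0 : xi != 0)
    (Q : super_vector_field K (@jet_bidegree d n p q) 0 1)
    (Qbar : super_vector_field K (@jet_bidegree d n p q) 0 (-1))
    (Q_BRST : is_gauge_BRST D f H S g xi Q)
    (Qbar_antiBRST : is_gauge_antiBRST D f H S g xi Qbar) :
  [/\ (forall u, supercommutator Qbar Qbar u = 2 * Qbar (Qbar u)) /\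
        (forall u, 2 * Qbar (Qbar u) = 0),
      (forall u, supercommutator Q Qbar u = Q (Qbar u) + Qbar (Q u)) /\
        (forall u, Q (Qbar u) + Qbar (Q u) = 0)
    & gauge_homological Qbar].
Proof.
have square u : Qbar (Qbar u) + Qbar (Qbar u) = 0.
  exact: (antiBRST_square f_lie H_rep S_rep Qbar_antiBRST).
have anticomm u : Q (Qbar u) + Qbar (Q u) = 0.
  exact: (BRST_antiBRST_anticomm f_lie H_rep S_rep Qbar_antiBRST Q_BRST).
have QbarQbar u : supercommutator Qbar Qbar u = 2 * Qbar (Qbar u).
  by rewrite /supercommutator /= expr1 mulN1r opprK mulr_natl.
have double u : 2 * Qbar (Qbar u) = 0 by rewrite mulr_natl; exact: square.
split; split=> // u.
- by rewrite /supercommutator /= expr1 mulN1r opprK.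
- by rewrite QbarQbar.
Qed.
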